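(* Let $\mathcal{X}$ be a linear space over $\mathbb{K}$ ($\mathbb{K}=\mathbb{R}$ or $\mathbb{C}$). Let $\mathbf{Mp}$ be the set of multivalued projections in $\mathcal{X}$, $\mathbf{Q}$ the set of projections in $\mathcal{X}$, $\mathbf{Mp}^2=\{PQ: P,Q\in\mathbf{Mp}\}$ and $\mathbf{Mp}\,\mathbf{Q}=\{PQ:P\in\mathbf{Mp},Q\in\mathbf{Q}\}$. Then $$\mathbf{Mp}^2=\mathbf{Mp}\,\mathbf{Q}.$$ Moreover, given $T\in\mathbf{Mp}^2$ there exist $P\in\mathbf{Mp}$ and $Q_0\in\mathbf{Q}$ with $\operatorname{ran}P=\operatorname{ran}T$, $\operatorname{mul}P=\operatorname{mul}T$, $\operatorname{dom}Q_0=\operatorname{dom}T$ and $\ker Q_0=\ker T$ such that $T=PQ_0$.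
   Context: A linear relation in $\mathcal{X}$ is a linear subspace $T$ of $\mathcal{X}\times\mathcal{X}$. Write $\operatorname{dom}T=\{x:\exists y,\ (x,y)\in T\}$, $\operatorname{ran}T=\{y:\exists x,\ (x,y)\in T\}$, $\ker T=\{x:(x,0)\in T\}$, $\operatorname{mul}T=\{y:(0,y)\in T\}$. The product is $ST=\{(x,z): (x,y)\in T \text{ and } (y,z)\in S\text{ for some }y\}$. A multivalued projection in $\mathcal{X}$ is a linear relation $P$ in $\mathcal{X}$ with $P^2=P$ and $\operatorname{ran}P\subseteq\operatorname{dom}P$; a projection is a multivalued projection $P$ with $\operatorname{mul}P=\{0\}$ (its domain need not be all of $\mathcal{X}$). *)

(* Defs.v *)
From HB Require Import structures.
From mathcomp Require Import all_boot all_order all_algebra.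
From mathcomp Require Import boolp classical_sets reals complex.

Set Implicit Arguments.
Unset Strict Implicit.
Unset Printing Implicit Defensive.

Import Order.TTheory GRing.Theory Num.Theory.

Local Open Scope classical_set_scope.
Local Open Scope ring_scope.

(* The two admissible scalar fields. A statement quantified over
   [k : scalar_kind] covers both the real and the complex case. *)
Inductive scalar_kind := RealScalars | ComplexScalars.

Definition scalars (R : realType) (k : scalar_kind) : fieldType :=
  match k with
  | RealScalars => R
  | ComplexScalars => R[i]
  end.

Section LinearRelations.
Context {K : fieldType} {X : lmodType K}.
Implicit Types S T P : set (X * X).

Definition linear_relation T := submod_closed (fun v : X * X => v \in T).

Definition rel_dom T : set X := T.`1.
Definition rel_ran T : set X := T.`2.
Definition rel_ker T : set X := [set x | T (x, 0)].
(* The multivalued part of T, not a product. *)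
Definition rel_mul T : set X := [set y | T (0, y)].

(* The product S T, in which T is applied first: (x, z) belongs to it when
   T (x, y) and S (y, z) for some y. *)
Definition rel_prod S T : set (X * X) := (S \; T)%relation.

Definition multivalued_projection P :=
  [/\ linear_relation P, rel_prod P P = P & rel_ran P `<=` rel_dom P].

Definition projection P := multivalued_projection P /\ rel_mul P = [set 0].

End LinearRelations.

Section Classes.
Context {K : fieldType} (X : lmodType K).

Definition Mp : set (set (X * X)) := [set P | multivalued_projection P].
Definition Q : set (set (X * X)) := [set P | projection P].

Definition Mp2 : set (set (X * X)) :=
  [set rel_prod A B | A in Mp & B in Mp].
Definition MpQ : set (set (X * X)) :=
  [set rel_prod A B | A in Mp & B in Q].

End Classes.

Arguments Mp {K} X.
Arguments Q {K} X.
Arguments Mp2 {K} X.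
Arguments MpQ {K} X.

(* Main.v *)
Require Import Defs.
From mathcomp Require Import all_boot all_order all_algebra.
From mathcomp Require Import boolp classical_sets reals complex.

(** A multivalued projection [P] is determined by its range [M] and its kernel
    [N]: it relates [x] to [y] exactly when [y] lies in [M] and [x - y] in [N]
    ([multivalued_projectionE]), and any two subspaces [M], [N] arise in this
    way ([mproj_multivalued]). Its domain is [M + N] and its multivalued part is
    [M `&` N], so it is a projection precisely when [M] and [N] are
    independent.

    Now let [T] be the product of the multivalued projection with range [M]
    and kernel [N] and the one with range [S] and kernel [L]; thus [T]
    relates [x] to [z] when [z] is in [M] and some [s] in [S] satisfies
    [x - s] in [L] and [s - z] in [N]. The right factor is multivalued as soon
    as [S] and [L] share a nonzero vector; it has to be replaced by one whose
    range is independent of its kernel.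
    - The new right factor [Q0] must have kernel [rel_ker T]. Its range [C] is
      a complement, inside [S `&` (M + N)], of the part of that subspace lying
      in [rel_ker T]; it exists by Zorn's lemma ([subspace_complement]). As
      [rel_ker T] contains [L], the sum [C + rel_ker T] is the whole domain of
      [T], and [Q0] sends every [x] in that domain to some [c] with [x - c] in
      [rel_ker T].
    - As [x] and [c] differ by an element of [rel_ker T], they have the same
      images under [T]. Hence [T] is determined by its values on [C], and
      the left factor [P] only has to realize these values, with range
      [rel_ran T] and multivalued part [rel_mul T]. For [c] in [S], the pair
      [(c, z)] belongs to [T] when [z] is in [M] and [c - z] is in
      [N + S `&` L]; this suggests the kernel [N + S `&` L] for [P], and that
      subspace meets [rel_ran T] exactly in [rel_mul T].
    [mproj_prod_factor] verifies these claims. *)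

Set Implicit Arguments.
Unset Strict Implicit.
Unset Printing Implicit Defensive.

Import GRing.Theory.

Local Open Scope classical_set_scope.
Local Open Scope ring_scope.

(** * Subspaces and their complements *)

Section Subspaces.
Context {K : fieldType} {V : lmodType K}.
Implicit Types A B C D : set V.

Definition subspace A :=
  A 0 /\ forall (a : K) u v, A u -> A v -> A (a *: u + v).

Definition sumspace A B : set V := [set x | exists2 a, A a & B (x - a)].

Lemma subspaceD A u v : subspace A -> A u -> A v -> A (u + v).
Proof. by move=> [_ AL] Au Av; rewrite -[u]scale1r; exact: AL. Qed.

Lemma subspaceN A u : subspace A -> A u -> A (- u).
Proof. by move=> [A0 AL] Au; rewrite -scaleN1r -[_ *: _]addr0; exact: AL. Qed.

Lemma subspaceB A u v : subspace A -> A u -> A v -> A (u - v).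
Proof. by move=> sA Au Av; apply: subspaceD => //; exact: subspaceN. Qed.

Lemma subspaceI A B : subspace A -> subspace B -> subspace (A `&` B).
Proof.
move=> [A0 AL] [B0 BL]; split=> // a u v [Au Bu] [Av Bv].
by split; [exact: AL | exact: BL].
Qed.

Lemma subspace_sum A B : subspace A -> subspace B -> subspace (sumspace A B).
Proof.
move=> [A0 AL] [B0 BL]; split; first by exists 0 => //; rewrite subr0.
move=> a u v [u' Au Bu] [v' Av Bv]; exists (a *: u' + v'); first exact: AL.
by rewrite opprD addrACA -scalerBr; exact: BL.
Qed.

(** A subspace of [D] that is maximal among those meeting [A] trivially already
    spans [D] modulo [A]: adjoining to it a vector [x] of [D] that is not
    congruent modulo [A] to one of its elements would keep the intersection
    with [A] trivial. *)
Lemma subspace_complement A D : subspace A -> subspace D ->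
  exists C, [/\ subspace C, C `<=` D, forall x, C x -> A x -> x = 0 &
    forall x, D x -> exists2 c, C c & A (x - c)].
Proof.
move=> sA sD.
(* The empty set is admitted among the candidates, so that the union of the
   empty chain is one of them. *)
pose ok C := [/\ forall (a : K) u v, C u -> C v -> C (a *: u + v), C `<=` D &
  forall x, C x -> A x -> x = 0].
have [F Fok Ftot|C [[CL CD CA] Cmax]] := @Zorn_bigcup V ok.
  split=> [a u v [X FX Xu] [Y FY Yv]|x [X FX Xx]|x [X FX Xx]].
  - have [XY|YX] := Ftot _ _ FX FY.
      by exists Y => //; have [YL _ _] := Fok _ FY; exact: YL (XY _ Xu) Yv.
    by exists X => //; have [XL _ _] := Fok _ FX; exact: XL Xu (YX _ Yv).
  - by have [_ XD _] := Fok _ FX; exact: XD.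
  - by have [_ _ XA] := Fok _ FX; exact: XA.
have C0 : C 0.
  apply: contrapT => nC0; apply: (Cmax (C `|` [set 0])).
    by split=> [x Cx|/(_ 0)]; [left | move=> CC; apply: nC0; apply: CC; right].
  split=> [a u v [Cu|->] [Cv|->]|x [/CD//|->]|x [/CA//|->//]].
  - by left; exact: CL.
  - left; case: (eqVneq u 0) => [u0|_]; first by rewrite -u0 in nC0.
    (* [a *: u] is reached from [u] alone, as [(a - 1) *: u + u]. *)
    by rewrite addr0 -[a](subrK 1) scalerDl scale1r; exact: CL.
  - by left; rewrite scaler0 add0r.
  - by right; rewrite scaler0 addr0.
  - by case: sD.
exists C; split=> // x Dx; apply: contrapT => nx.
apply: (Cmax [set v | exists a, C (v - a *: x)]).
  split=> [v Cv|sub]; first by exists 0; rewrite scale0r subr0.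
  apply: nx; exists x; last by rewrite subrr; case: sA.
  by apply: sub; exists 1; rewrite scale1r subrr.
split=> [a u v [b Cu] [c Cv]|v [a Cv]|v [a Cv] Av].
- exists (a * b + c).
  by rewrite scalerDl opprD addrACA -scalerA -scalerBr; exact: CL.
- rewrite -(subrK (a *: x) v) addrC; case: sD => D0 DL.
  by apply: DL => //; exact: CD.
- have [a0|a0] := eqVneq a 0.
    by move: Cv; rewrite a0 scale0r subr0 => Cv; exact: CA.
  case: nx; exists (- a^-1 *: (v - a *: x)).
    by rewrite -[_ *: _]addr0; exact: CL.
  have -> : x - - a^-1 *: (v - a *: x) = a^-1 *: v + 0.
    by rewrite scaleNr opprK scalerBr scalerA mulVf// scale1r addr0 addrC subrK.
  by case: sA => A0 AL; exact: AL.
Qed.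

End Subspaces.

(** * Multivalued projections in terms of range and kernel *)

Section MultivaluedProjections.
Context {K : fieldType} {X : lmodType K}.
Implicit Types (T P : set (X * X)) (M N S L : set X).

Lemma linear_relationE T : linear_relation T <-> subspace T.
Proof.
split=> -[T0 TL]; split.
- by rewrite inE in T0.
- by move=> a u v Tu Tv; have := TL a u v; rewrite !inE; exact.
- exact: mem_set.
- by move=> a u v /set_mem Tu /set_mem Tv; apply: mem_set; exact: TL.
Qed.

Lemma subspace_ran T : subspace T -> subspace (rel_ran T).
Proof.
move=> [T0 TL]; split=> [|a u v [x Tu] [y Tv]]; first by exists 0.
by exists (a *: x + y); exact: TL Tu Tv.
Qed.

Lemma subspace_ker T : subspace T -> subspace (rel_ker T).
Proof.
move=> [T0 TL]; split=> [//|a u v Tu Tv].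
have : T (a *: u + v, a *: 0 + 0) := TL a _ _ Tu Tv.
by rewrite scaler0 addr0.
Qed.

Lemma subspace_prod P T : subspace P -> subspace T -> subspace (rel_prod P T).
Proof.
move=> [P0 PL] [T0 TL]; split=> [|a [u u'] [v v'] [x Tx Px] [y Ty Py]].
  by exists 0.
by exists (a *: x + y); [exact: TL Tx Ty | exact: PL Px Py].
Qed.

(** The linear relation sending [m + n] to [m], for [m] in [M] and [n] in [N];
    the summand [n] is read off as a difference. *)
Definition mproj M N : set (X * X) := [set xy | M xy.2 /\ N (xy.1 - xy.2)].

Lemma subspace_mproj M N : subspace M -> subspace N -> subspace (mproj M N).
Proof.
move=> [M0 ML] [N0 NL]; split; first by split; rewrite //= subr0.
move=> a [x x'] [y y'] [/= Mx Nx] [/= My Ny]; split=> /=; first exact: ML.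
by rewrite opprD addrACA -scalerBr; exact: NL.
Qed.

Lemma ran_mproj M N : subspace N -> rel_ran (mproj M N) = M.
Proof.
move=> [N0 _]; apply/seteqP; split=> [y [x []]//|y My].
by exists y; split; rewrite //= subrr.
Qed.

Lemma ker_mproj M N : subspace M -> rel_ker (mproj M N) = N.
Proof.
move=> [M0 _]; apply/seteqP; split=> [x [_]|x Nx]; first by rewrite /= subr0.
by split; rewrite //= subr0.
Qed.

Lemma mul_mproj M N : subspace N -> rel_mul (mproj M N) = M `&` N.
Proof.
move=> sN; apply/seteqP; split=> [y [/= My Ny]|y [My Ny]]; split=> //=.
  by rewrite -[y]opprK -[- y]sub0r; exact: subspaceN.
by rewrite sub0r; exact: subspaceN.
Qed.

Lemma mproj_multivalued M N : subspace M -> subspace N ->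
  multivalued_projection (mproj M N).
Proof.
move=> sM sN; split; first exact/linear_relationE/subspace_mproj.
  apply/seteqP; split=> -[x y] /=.
    move=> [z [/= Mz Nz] [/= My Ny]]; split=> //=.
    by rewrite -[x](subrK z) -addrA; exact: subspaceD.
  move=> [/= My Ny]; exists y; split; rewrite //= subrr.
  by case: sN.
rewrite ran_mproj// => y My; exists y; split; rewrite //= subrr.
by case: sN.
Qed.

Lemma mproj_projection M N : subspace M -> subspace N ->
  (forall x, M x -> N x -> x = 0) -> projection (mproj M N).
Proof.
move=> sM sN MN; split; first exact: mproj_multivalued.
rewrite mul_mproj//; apply/seteqP; split=> [x [Mx Nx]|_ ->]; first exact: MN.
by case: sM; case: sN.
Qed.

(** Idempotence together with [rel_ran P `<=` rel_dom P] makes [P] contain the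
    diagonal of its range; then [(x, y)] in [P] is the sum of [(y, y)] and
    [(x - y, 0)]. *)
Lemma multivalued_projectionE P : multivalued_projection P ->
  P = mproj (rel_ran P) (rel_ker P).
Proof.
move=> [/linear_relationE sP PP Pdom].
have Pdiag y : rel_ran P y -> P (y, y).
  move=> ry; have [w yw] := Pdom _ ry; case: ry => x xy.
  have xw : P (x, w) by rewrite -PP; exists y.
  have : P (y - (x - x), w - (w - y)) := subspaceB sP yw (subspaceB sP xw xy).
  by rewrite subrr subr0 subKr.
apply/seteqP; split=> -[x y] => [xy|[/= /Pdiag yy xy]].
  have ry : rel_ran P y by exists x.
  split=> //=; have : P (x - y, y - y) := subspaceB sP xy (Pdiag _ ry).
  by rewrite subrr.
have : P (x - y + y, 0 + y) := subspaceD sP xy yy.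
by rewrite subrK add0r.
Qed.

(** * Making the right factor single-valued *)

Lemma mproj_prod_factor M N S L (T := rel_prod (mproj M N) (mproj S L)) :
  subspace M -> subspace N -> subspace S -> subspace L ->
  exists P Q0 : set (X * X),
    [/\ Mp X P, Q X Q0, rel_ran P = rel_ran T & rel_mul P = rel_mul T] /\
    [/\ rel_dom Q0 = rel_dom T, rel_ker Q0 = rel_ker T & T = rel_prod P Q0].
Proof.
move=> sM sN sS sL.
have sT : subspace T by apply: subspace_prod; exact: subspace_mproj.
have sk := subspace_ker sT; have sr := subspace_ran sT.
have sSL := subspaceI sS sL.
have sN' := subspace_sum sN sSL.
have ranM z : rel_ran T z -> M z by move=> [x [s _ []]].
have Lker x : L x -> rel_ker T x.
  move=> Lx; have [S0 _] := sS; have [M0 _] := sM; have [N0 _] := sN.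
  by exists 0; split; rewrite //= subr0.
have kerD x c z : rel_ker T (x - c) -> T (c, z) -> T (x, z).
  move=> Txc Tcz; have : T (x - c + c, 0 + z) := subspaceD sT Txc Tcz.
  by rewrite subrK add0r.
have [C [sC CS kC Csum]] :=
  subspace_complement sk (subspaceI sS (subspace_sum sM sN)).
have Tcong x z : T (x, z) ->
    exists s c, [/\ S s, N (s - z), C c, rel_ker T (s - c) & rel_ker T (x - c)].
  move=> [s [/= Ss Lxs] [/= Mz Nsz]].
  have [|c Cc Tsc] := Csum s; first by split=> //; exists z.
  exists s, c; split=> //.
  by rewrite -[x](subrK s) -addrA; apply: subspaceD => //; exact: Lker.
exists (mproj (rel_ran T) (sumspace N (S `&` L))), (mproj C (rel_ker T)).
split; split.
- exact: mproj_multivalued.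
- exact: mproj_projection.
- exact: ran_mproj.
- rewrite mul_mproj//; apply/seteqP; split=> z.
    move=> [/ranM Mz [n Nn [Szn Lzn]]]; exists (z - n); split=> //=.
      by rewrite sub0r; exact: subspaceN.
    by rewrite addrC addKr; exact: subspaceN.
  move=> Tz; split; first by exists 0.
  case: Tz => s [/= Ss]; rewrite sub0r => Ls [/= _ Nsz].
  exists (z - s); first by rewrite -opprB; exact: subspaceN.
  rewrite subKr; split=> //; rewrite -[s]opprK; exact: subspaceN.
- apply/seteqP; split=> x.
    move=> [c [/= Cc Txc]]; have [Sc [m Mm Ncm]] := CS _ Cc.
    exists m; apply: kerD Txc _; exists c; split; rewrite //= subrr.
    by case: sL.
  by move=> [z /Tcong[s [c [_ _ Cc _ Txc]]]]; exists c.
- exact: ker_mproj.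
- apply/seteqP; split=> -[x z] /=.
    move=> Txz; have rz : rel_ran T z by exists x.
    have [s [c [Ss Nsz Cc Tsc Txc]]] := Tcong _ _ Txz.
    exists c; split=> //=.
    case: Tsc => t [/= St Lt] [/= _]; rewrite subr0 => Nt.
    exists (s - z - t); first exact: subspaceB.
    (* The remainder [t - (s - c)] is in [L] by the choice of [t], and in [S]
       since [t], [s] and [c] are. *)
    have -> : c - z - (s - z - t) = t - (s - c).
      by rewrite [s - z - t]addrAC opprB addrA subrK !opprB addrCA.
    have [Sc _] := CS _ Cc; split; first by do 2?apply: subspaceB.
    by rewrite -opprB; exact: subspaceN.
  move=> [c [/= Cc Txc] [/= /ranM Mz [n Nn [Sl Ll]]]].
  apply: kerD Txc _; have [Sc _] := CS _ Cc.
  exists (c - (c - z - n)); split=> //=.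
  + exact: subspaceB.
  + by rewrite subKr.
  + by rewrite addrAC subKr.
Qed.

End MultivaluedProjections.

Theorem theorem6p2 (R : realType) (k : scalar_kind)
    (X : lmodType (scalars R k)) :
  Mp2 X = MpQ X /\
  (forall T : set (X * X), Mp2 X T ->
    exists P Q0 : set (X * X),
      [/\ Mp X P, Q X Q0, rel_ran P = rel_ran T & rel_mul P = rel_mul T] /\
      [/\ rel_dom Q0 = rel_dom T, rel_ker Q0 = rel_ker T & T = rel_prod P Q0]).
Proof.
have factor (T : set (X * X)) : Mp2 X T ->
    exists P Q0 : set (X * X),
      [/\ Mp X P, Q X Q0, rel_ran P = rel_ran T & rel_mul P = rel_mul T] /\
      [/\ rel_dom Q0 = rel_dom T, rel_ker Q0 = rel_ker T & T = rel_prod P Q0].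
  move=> [A mA [B mB <-]].
  rewrite (multivalued_projectionE mA) (multivalued_projectionE mB).
  case: mA mB => [/linear_relationE sA _ _] [/linear_relationE sB _ _].
  by apply: mproj_prod_factor;
     (exact: subspace_ran || exact: subspace_ker).
split=> //; apply/seteqP; split=> T.
  by move=> /factor[P [Q0 [[mP qQ0 _ _] [_ _ ->]]]]; exists P => //; exists Q0.
by move=> [A mA [B [mB _] <-]]; exists A => //; exists B.
Qed.
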